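(* Let $(\mathcal{X}, \mathcal{T}, g)$ be a compact $n$-dimensional indefinite metric polyhedron with edge set $\mathcal{E}$. Then $\mathcal{X}$ admits a simplicial isometric embedding into $\mathbb{R}^{p,q}$ for some integers $p$ and $q$ which satisfy $p \geq 2n+1$ and $p + q = 2n + 1 + |\mathcal{E}|$.
   Context: An indefinite metric polyhedron is a triple $(\mathcal{X}, \mathcal{T}, g)$ where $\mathcal{X}$ is a topological space, $\mathcal{T}$ is a locally finite simplicial triangulation of $\mathcal{X}$ with vertex set $\mathcal{V}$ and edge set $\mathcal{E}$, and $g : \mathcal{E} \to \mathbb{R}$ is an arbitrary function. It is $n$-dimensional if $n$ is the maximal dimension of a simplex of $\mathcal{T}$. When $\mathcal{X}$ is compact, $\mathcal{T}$ is finite. Minkowski space $\mathbb{R}^{p,q}$ ($p,q\ge 0$) is $\mathbb{R}^{p+q}$ endowed with the symmetric bilinear form $\langle \vec v, \vec w\rangle = \sum_{i=1}^{p} v_i w_i - \sum_{j=p+1}^{p+q} v_j w_j$. A simplicial map from $\mathcal{X}$ to $\mathbb{R}^N$ is a map that is affine (in barycentric coordinates) on each simplex of $\mathcal{T}$; it is determined by its values on $\mathcal{V}$. The signed square is $s(x) = x^2$ for $x \ge 0$ and $s(x) = -x^2$ for $x<0$; put $g^2(e) := s(g(e))$ for $e \in \mathcal{E}$. A simplicial isometric embedding of $(\mathcal{X}, \mathcal{T}, g)$ into $\mathbb{R}^{p,q}$ is a simplicial map $h : \mathcal{X} \to \mathbb{R}^{p,q}$ that is a topological embedding and satisfies $\langle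 h(v_i) - h(v_j), h(v_i) - h(v_j)\rangle = g^2(e_{ij})$ for every edge $e_{ij} \in \mathcal{E}$ with endpoints $v_i, v_j$. *)

(* Defs.v *)
From HB Require Import structures.
From mathcomp Require Import all_boot all_order all_algebra finmap.
From mathcomp Require Import all_classical all_reals all_analysis.

Set Implicit Arguments.
Unset Strict Implicit.
Unset Printing Implicit Defensive.

Import Order.TTheory GRing.Theory Num.Theory.
Import numFieldNormedType.Exports.
Local Open Scope classical_set_scope.
Local Open Scope ring_scope.

Definition homeomorphism (X Y : topologicalType) (f : X -> Y) : Prop :=
  exists g : Y -> X,
    [/\ cancel f g, cancel g f, continuous f & continuous g].

(* A homeomorphism onto the image; [range f], used as a type, carries the
   topology induced by Y. *)
Definition topological_embedding (X Y : topologicalType) (f : X -> Y) : Prop :=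
  exists2 e : X -> range f, homeomorphism e & forall x, set_val (e x) = f x.

Record simplicial_complex (V : choiceType) := SimplicialComplex {
  simplices : set {fset V};
  simplices_neq0 : forall s, simplices s -> s != fset0;
  simplices_sub : forall s t : {fset V},
    simplices s -> (t `<=` s)%fset -> t != fset0 -> simplices t;
  simplices1 : forall v : V, simplices [fset v]%fset }.

Definition edges (V : choiceType) (K : simplicial_complex V) : set {fset V} :=
  [set e | simplices K e /\ #|` e| = 2%N].

Definition complex_dim (V : choiceType) (K : simplicial_complex V) (n : nat) :
    Prop :=
  (exists2 s, simplices K s & #|` s| = n.+1)
  /\ forall s, simplices K s -> (#|` s| <= n.+1)%N.

Definition locally_finite (V : choiceType) (K : simplicial_complex V) : Prop :=
  forall v : V, finite_set [set s | simplices K s /\ v \in s].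

Section realization.
Variables (R : realType) (V : choiceType).

(* The simplex spanned by s, in barycentric coordinates. *)
Definition simplex (s : {fset V}) : set {ptws V -> R} :=
  [set x | [/\ forall v, 0 <= x v, forall v, v \notin s -> x v = 0
             & \sum_(v <- s) x v = 1]].

Variable K : simplicial_complex V.

Definition realization_set : set {ptws V -> R} :=
  \bigcup_(s in simplices K) simplex s.

Definition realization : Type := realization_set.

HB.instance Definition _ := Choice.on realization.

Definition bary (x : realization) : {ptws V -> R} := \val x.

(* Coherent topology: a set is open iff it meets each simplex in a subset open
   for the Euclidean topology of that simplex (on which this topology coincides
   with that of pointwise convergence). *)
Definition realization_open (U : set realization) : Prop :=
  forall s, simplices K s ->
    open ((set_val : simplex s -> _) @^-1` (bary @` U)).

Lemma realization_openT : realization_open setT.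
Proof.
move=> s Ks; rewrite (_ : _ @^-1` _ = setT); first exact: openT.
apply/seteqP; split=> // x _ /=.
have sx : realization_set (set_val x) by exists s => //; exact: set_valP.
by exists (SigSub (mem_set sx)).
Qed.

Lemma realization_openI (A B : set realization) :
  realization_open A -> realization_open B -> realization_open (A `&` B).
Proof.
move=> oA oB s Ks.
rewrite (_ : bary @` (A `&` B) = bary @` A `&` bary @` B).
  by rewrite preimage_setI; apply: openI; [exact: oA | exact: oB].
apply/seteqP; split=> [_ [x [Ax Bx] <-]|_ [[x Ax <-] [y By /val_inj yx]]].
  by split; exists x.
by exists x => //; split=> //; rewrite -yx.
Qed.

Lemma realization_open_bigcup (I : Type) (f : I -> set realization) :
  (forall i, realization_open (f i)) -> realization_open (\bigcup_i f i).
Proof.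
move=> of_ s Ks; rewrite image_bigcup preimage_bigcup.
by apply: bigcup_open => i _; exact: of_.
Qed.

HB.instance Definition _ := isOpenTopological.Build realization
  realization_openT realization_openI realization_open_bigcup.

Fact vertex_point_subproof (v : V) :
  realization_set (fun w => (w == v)%:R : R).
Proof.
exists [fset v]%fset; first exact: simplices1.
split=> [w|w|]; first exact: ler0n.
  by rewrite inE => /negbTE ->.
by rewrite big_seq_fset1 eqxx.
Qed.

Definition vertex_point (v : V) : realization :=
  SigSub (mem_set (vertex_point_subproof v)).

End realization.

(* The triangulation is a homeomorphism from the geometric realization of an
   abstract simplicial complex. *)
Record metric_polyhedron (R : realType) := MetricPolyhedron {
  space :> topologicalType;
  vertex : choiceType;
  complex : simplicial_complex vertex;
  complex_locally_finite : locally_finite complex;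
  triangulation : realization R complex -> space;
  triangulation_homeo : homeomorphism triangulation;
  edge_value : edges complex -> R }.

Section embeddings.
Variables (R : realType) (P : metric_polyhedron R).

Definition vertex_in (v : vertex P) : P :=
  triangulation (vertex_point R (complex P) v).

Definition simplicial_map (N : nat) (h : P -> 'rV[R]_N) : Prop :=
  forall (s : {fset vertex P}) (x : realization R (complex P)),
    simplices (complex P) s -> simplex s (bary x) ->
    h (triangulation x) = \sum_(v <- s) bary x v *: h (vertex_in v).

Definition minkowski_form (p q : nat) (v w : 'rV[R]_(p + q)) : R :=
  \sum_(i < p) v 0 (lshift q i) * w 0 (lshift q i)
  - \sum_(j < q) v 0 (rshift p j) * w 0 (rshift p j).

Definition signed_square (x : R) : R := if 0 <= x then x ^+ 2 else - (x ^+ 2).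

Definition simplicial_isometric_embedding (p q : nat)
    (h : P -> 'rV[R]_(p + q)) : Prop :=
  [/\ simplicial_map h, topological_embedding h
    & forall (e : edges (complex P)) (v w : vertex P),
        set_val e = [fset v; w]%fset ->
        minkowski_form (h (vertex_in v) - h (vertex_in w))
                       (h (vertex_in v) - h (vertex_in w))
        = signed_square (edge_value e)].

End embeddings.

(* Main.v *)
Require Import Defs.
From HB Require Import structures.
From mathcomp Require Import all_boot all_order all_algebra finmap.
From mathcomp Require Import all_classical all_reals all_analysis.
From mathcomp Require Import zify ring.

Set Implicit Arguments.
Unset Strict Implicit.
Unset Printing Implicit Defensive.

Import Order.TTheory GRing.Theory Num.Theory.
Import numFieldNormedType.Exports.
Local Open Scope classical_set_scope.
Local Open Scope ring_scope.

(** The proof separates the metric from the topology: enough coordinates are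
    spent on making the map injective, and the others on correcting the metric.

    Injectivity.  Compactness makes the vertex set finite, because the open
    stars of the vertices cover the polyhedron and each contains one vertex
    only ([compact_realization_vertices]).  Place the vertices at distinct
    points of the moment curve (t, t^2, ..., t^(2n+1)).  Two simplices of
    dimension at most n have together at most 2n+2 vertices, and any 2n+2
    points of that curve are affinely independent ([moment_curve_free]), so
    the simplicial extension is injective ([simplicial_extension_inj]).  It
    stays injective whatever further coordinates are added, and a continuous
    injection from a compact space to a Hausdorff space is an embedding
    ([compact_topological_embedding]).

    Metric.  A real function f on the vertices, used as one more coordinate,
    changes the squared length of each edge vw by (f v - f w)^2, with sign + or
    - according to the kind of coordinate.  Such vectors of squares span the
    space of all functions on the edges: for an edge vw, the indicators of {v},
    {w} and {v, w} give the cut vectors of these sets, and cut {v} + cut {w} -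
    cut {v, w} is twice the indicator of the edge vw.  A basis can therefore be
    chosen among them, which consists of |E| functions
    ([squared_differences_basis]).  The difference between the prescribed
    squared lengths and those given by the moment curve is a combination of
    this basis; the functions with a coefficient c >= 0, scaled by sqrt c,
    become positive coordinates, and those with c < 0, scaled by sqrt (- c),
    negative ones ([diagonal_form_minkowski]).  This adds exactly |E|
    coordinates to the 2n+1 positive ones of the moment curve. *)

(** * Embeddings of compact spaces *)

(** Closed sets of X are compact, hence so are their images, which are then
    closed in Y: this is the continuity of the inverse. *)
Lemma compact_topological_embedding (X Y : topologicalType) (f : X -> Y) :
  compact [set: X] -> hausdorff_space Y -> continuous f -> injective f ->
  topological_embedding f.
Proof.
move=> cX hY cf injf.
have frange x : range f (f x) by exists x.
pose e x : range f := SigSub (mem_set (frange x)).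
pose g (y : range f) : X := projT1 (cid2 (set_valP y)).
have gE y : f (g y) = set_val y by rewrite /g; case: cid2.
exists e => //; exists g; split.
- by move=> x; apply: injf; rewrite gE.
- by move=> y; apply: val_inj; rewrite -[RHS]gE.
- exact: continuous_comp_initial.
- apply/continuous_closedP => A cA.
  have -> : g @^-1` A = set_val @^-1` (f @` A).
    apply/seteqP; split=> y /=; first by exists (g y) => //; rewrite gE.
    by case=> x Ax; rewrite -gE => /injf <-.
  apply: closed_comp; first by move=> y _; exact: initial_continuous.
  apply: compact_closed => //; apply: continuous_compact.
    exact: continuous_subspaceT.
  exact: (subclosed_compact cA cX).
Qed.

(** * Geometric realizations *)

Lemma simplex_sum (R : realType) (V : choiceType) (s A : {fset V})
    (x : {ptws V -> R}) (M : lmodType R) (F : V -> M) :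
  simplex s x -> (s `<=` A)%fset ->
  \sum_(v <- A) x v *: F v = \sum_(v <- s) x v *: F v.
Proof.
case=> _ x0 _ sA; symmetry; apply: big_fset_incl => // v _ /x0 ->.
by rewrite scale0r.
Qed.

Section realization_topology.
Variables (R : realType) (V : choiceType) (K : simplicial_complex V).

(** In the coherent topology this need only be checked on each simplex, where
    a barycentric coordinate is a projection of the ambient product. *)
Lemma bary_continuous (v : V) :
  continuous (fun x : realization R K => bary x v).
Proof.
apply/continuousP => U oU.
(* States the goal through the definition of the topology, trace by trace. *)
change (realization_open ((fun x : realization R K => bary x v) @^-1` U)).
move=> s Ks.
rewrite (_ : _ @^-1` _ =
    (fun z : simplex (R:=R) s => (set_val z : V -> R) v) @^-1` U).
  apply: open_comp => // z _.
  apply: (@continuous_comp _ _ _ (set_val : simplex (R:=R) s -> {ptws V -> R})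
    (fun z => z v)); first exact: initial_continuous.
  exact: (@proj_continuous V (fun=> R)).
apply/seteqP; split=> z /=; first by case=> x Ux <-.
move=> Uz.
have Kz : realization_set K (set_val z) by exists s => //; exact: set_valP.
by exists (SigSub (mem_set Kz)).
Qed.

(** The open star of v, where the coordinate of v is positive, has v as its
    only vertex, so that a finite subcover by open stars uses all vertices. *)
Lemma compact_realization_vertices :
  compact [set: realization R K] -> exists A : {fset V}, forall v, v \in A.
Proof.
move=> cK.
have [[v0 _]|noV] := pselect (exists v : V, True); last first.
  by exists fset0 => v; case: noV; exists v.
pose pK : ptopologicalType :=
  HB.pack (realization R K) (isPointed.Build _ (vertex_point R K v0)).
have : cover_compact [set: pK] by rewrite -compact_cover.
pose star v : set pK := [set x : realization R K | 0 < bary x v].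
move=> /(_ V setT star) [v _| x _ |A _ covA].
- have := @bary_continuous v; move=> /continuousP /(_ [set r | 0 < r]); apply.
  exact: open_gt.
- case: (set_valP x) => s Ks [x_ge0 _ x1].
  have [v _ xv] : exists2 v, v \in s & 0 < (bary x v).
    apply: contrapT => no; move: x1; rewrite big_seq big1 => [/eqP|v vs].
      by rewrite eq_sym oner_eq0.
    apply/eqP; apply: contra_notT no => xv; exists v => //.
    by rewrite lt_neqAle eq_sym xv /=; exact: x_ge0.
  by exists v.
exists A => v.
have [w /= wA] := covA (vertex_point R K v) I.
by rewrite /star /= /bary /=; case: eqP => [<-//|_]; rewrite ltxx.
Qed.

End realization_topology.

(** * Points of the moment curve *)

(** Affine independence of points of the moment curve, where the exponent 0
    carries the condition that the coefficients add up to 0.  Multiplied by the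
    coefficients of the polynomial that vanishes at all the t w but t v, the
    power sums leave z v alone; this replaces a Vandermonde determinant. *)
Lemma moment_curve_free (F : fieldType) (V : choiceType) (t : V -> F)
    (A : {fset V}) (z : V -> F) :
  {in A &, injective t} ->
  (forall k, (k < #|` A|)%N -> \sum_(v <- A) z v * t v ^+ k = 0) ->
  {in A, z =1 fun=> 0}.
Proof.
move=> injt z0 v vA.
pose p := \prod_(w <- (A `\ v)%fset) ('X - (t w)%:P).
have szp : size p = #|` A| by rewrite size_prod_XsubC (cardfsD1 v A) vA.
have pv : p.[t v] != 0.
  rewrite horner_prod big_seq; apply: (big_ind (fun x => x != 0)).
  - exact: oner_neq0.
  - by move=> x y; exact: mulf_neq0.
  - move=> w; rewrite !inE => /andP[wv wA].
    by rewrite !hornerE subr_eq0; apply: contraNneq wv => /(injt _ _ vA wA) ->.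
have : \sum_(w <- A) z w * p.[t w] = 0.
  under eq_bigr do rewrite horner_coef big_distrr /=.
  rewrite exchange_big /= big1 // => k _.
  under eq_bigr do rewrite mulrCA.
  by rewrite -big_distrr /= z0 ?mulr0 // -szp.
rewrite (big_fsetD1 v) //= big_seq big1 ?addr0 => [/eqP|w wA].
  by rewrite mulf_eq0 (negPf pv) orbF => /eqP.
by rewrite horner_prod (big_fsetD1 w) //= hornerXsubC subrr mul0r mulr0.
Qed.

(** * Simplicial extensions *)

Section simplicial_extension.
Variables (R : realType) (V : choiceType) (K : simplicial_complex V).
Variables (A : {fset V}) (N : nat) (H : V -> 'rV[R]_N).
Hypothesis inA : forall v, v \in A.

Definition simplicial_extension (x : realization R K) : 'rV[R]_N :=
  \sum_(v <- A) bary x v *: H v.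

Let subA (s : {fset V}) : (s `<=` A)%fset.
Proof. by apply/fsubsetP => v _. Qed.

Lemma simplicial_extensionE s x : simplex s (bary x) ->
  simplicial_extension x = \sum_(v <- s) bary x v *: H v.
Proof. by move=> sx; rewrite /simplicial_extension (simplex_sum _ sx). Qed.

Lemma simplicial_extension_vertex v :
  simplicial_extension (vertex_point R K v) = H v.
Proof.
rewrite (@simplicial_extensionE [fset v]%fset) /bary /=; last first.
  split=> [w|w|]; first exact: ler0n.
    by rewrite inE => /negbTE ->.
  by rewrite big_seq_fset1 eqxx.
by rewrite big_seq_fset1 eqxx scale1r.
Qed.

Lemma simplicial_extension_continuous : continuous simplicial_extension.
Proof.
apply: continuous_big => [|v _ x]; first exact: add_continuous.
apply: cvgZr_tmp; first exact: (@nbhs_filter _ x).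
exact: (@bary_continuous _ _ K v x).
Qed.

(** Two points with the same image give a relation between the at most 2n+2
    vertices of the simplices that contain them, whose coefficients are the
    differences of barycentric coordinates; on the moment curve it is trivial.
    The other coordinates, outside the image of r, remain available
    for the metric. *)
Lemma simplicial_extension_inj (n : nat) (t : V -> R)
    (r : 'I_(2 * n + 1) -> 'I_N) :
  (forall s, simplices K s -> (#|` s| <= n.+1)%N) -> injective t ->
  (forall v i, H v 0 (r i) = t v ^+ i.+1) -> injective simplicial_extension.
Proof.
move=> dim_le injt Hr x y hxy.
have [s Ks sx] := set_valP x; have [s' Ks' sy] := set_valP y.
set z := fun v => bary x v - bary y v.
have zE (F : V -> R) : \sum_(v <- (s `|` s')%fset) z v * F v =
    \sum_(v <- A) bary x v * F v - \sum_(v <- A) bary y v * F v.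
  have sumE s0 x0 : simplex s0 x0 -> (s0 `<=` s `|` s')%fset ->
      \sum_(v <- A) x0 v * F v = \sum_(v <- (s `|` s')%fset) x0 v * F v.
    move=> s0x0 s0s; transitivity (\sum_(v <- s0) x0 v * F v).
      exact: (simplex_sum (M := R^o) F s0x0 (subA s0)).
    by rewrite -(simplex_sum (M := R^o) F s0x0 s0s).
  rewrite (sumE _ _ sx (fsubsetUl _ _)) (sumE _ _ sy (fsubsetUr _ _)).
  by rewrite -sumrB; apply: eq_bigr => v _; rewrite mulrBl.
have z0 k : (k < #|` s `|` s'|)%fset%N ->
    \sum_(v <- (s `|` s')%fset) z v * t v ^+ k = 0.
  case: k => [_|k kn]; rewrite zE.
    have sum1 s0 x0 : simplex s0 x0 -> \sum_(v <- A) x0 v * t v ^+ 0 = 1.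
      move=> s0x0; have [_ _ <-] := s0x0.
      rewrite [LHS](simplex_sum (M := R^o) _ s0x0 (subA s0)).
      by apply: eq_bigr => v _; rewrite expr0 [LHS]mulr1.
    by rewrite (sum1 _ _ sx) (sum1 _ _ sy) subrr.
  have kd : (k < 2 * n + 1)%N.
    have := dim_le _ Ks; have := dim_le _ Ks'.
    by move: kn; rewrite cardfsU; lia.
  have hE x0 : simplicial_extension x0 0 (r (Ordinal kd)) =
      \sum_(v <- A) bary x0 v * t v ^+ k.+1.
    by rewrite summxE; apply: eq_bigr => v _; rewrite mxE Hr.
  by rewrite -!hE hxy subrr.
have zv := moment_curve_free (in2W injt) z0.
apply: val_inj; apply/funext => v.
have [vs|] := boolP (v \in (s `|` s')%fset).
  by apply/eqP; rewrite -subr_eq0; apply/eqP; exact: (zv v vs).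
rewrite inE negb_or => /andP[vs vs'].
by have [_ -> // _] := sx; have [_ -> // _] := sy.
Qed.

End simplicial_extension.

(** * Prescribing the squared lengths of edges *)

(** The members of a spanning family that form a basis are chosen once, before
    the vector d that is to be decomposed. *)
Lemma spanning_subfamily (F : fieldType) (k m : nat) (A : 'M[F]_(k, m)) :
  row_full A -> exists r : 'I_m -> 'I_k, forall d : 'I_m -> F,
    exists c : 'I_m -> F, forall j, d j = \sum_i c i * A (r i) j.
Proof.
move=> fA; exists (fullrankfun fA) => d.
pose B := rowsub (fullrankfun fA) A.
pose c := \row_j d j *m invmx B.
exists (c 0) => j.
have : c *m B = \row_j d j by rewrite mulmxKV // fullrowsub_unit.
by move=> /rowP/(_ j); rewrite !mxE => <-; apply: eq_bigr => i _; rewrite !mxE.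
Qed.

(** Each indicator of an edge is half of a signed sum of three cut vectors, so
    the cut vectors span the functions on the edges. *)
Lemma squared_differences_basis (F : numFieldType) (V : choiceType) (m : nat)
    (a b : 'I_m -> V) :
  (forall i, a i != b i) ->
  (forall i j, [fset a i; b i]%fset = [fset a j; b j]%fset -> i = j) ->
  exists f : 'I_m -> V -> F, forall d : 'I_m -> F,
    exists c : 'I_m -> F,
      forall j, d j = \sum_i c i * (f i (a j) - f i (b j)) ^+ 2.
Proof.
move=> ab inj_ab.
(* The candidates: the indicators of the {a i}, of the {b i} and of the
   {a i, b i}; A lists the squared differences of each of them. *)
pose ind (S : V -> bool) v : F := (S v)%:R.
pose phi (i : 'I_(m + m + m)) : V -> F :=
  match fintype.split i with
  | inl i => match fintype.split i with
             | inl i => ind (pred1 (a i)) | inr i => ind (pred1 (b i)) end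
  | inr i => ind (pred2 (a i) (b i))
  end.
pose sq (f : V -> F) j := (f (a j) - f (b j)) ^+ 2.
pose A := \matrix_(i, j) sq (phi i) j.
pose A1 := \matrix_(i, j) sq (ind (pred1 (a i))) j.
pose A2 := \matrix_(i, j) sq (ind (pred1 (b i))) j.
pose A3 := \matrix_(i, j) sq (ind (pred2 (a i) (b i))) j.
have AE : A = col_mx (col_mx A1 A2) A3.
  apply/matrixP => i j; rewrite !mxE /phi.
  case: (fintype.split i) => i'; rewrite mxE //.
  by case: (fintype.split i') => i''; rewrite mxE.
(* The cut of {a i, b i} differs from the sum of the two others on the edge i
   only, whose endpoints it does not separate. *)
have A123 : A1 + A2 - A3 = 2%:M.
  apply/matrixP => i j; rewrite !mxE /sq /ind /=.
  have [<-|ij] := eqVneq i j.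
    by rewrite !eqxx (eq_sym (b i)) (negPf (ab i)) /=; ring.
  have nx : ~~ ((a j == a i) && (b j == b i)).
    apply: contra_neqN ij => /andP[/eqP e1 /eqP e2].
    by apply: inj_ab; rewrite e1 e2.
  have ny : ~~ ((b j == a i) && (a j == b i)).
    apply: contra_neqN ij => /andP[/eqP e1 /eqP e2].
    by apply: inj_ab; rewrite e1 e2 fsetUC.
  (* With nx and ny, this leaves only truth values of the four equalities
     for which both sides agree. *)
  have excl (x y z : V) : y != z -> ~~ ((x == y) && (x == z)).
    by apply: contra_neqN => /andP[/eqP <- /eqP].
  have := excl (a i) _ _ (ab j); have := excl (b i) _ _ (ab j).
  have := excl (a j) _ _ (ab i); have := excl (b j) _ _ (ab i).
  rewrite !(eq_sym (a i)) !(eq_sym (b i)); move: nx ny.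
  by case: (a j == a i); case: (b j == a i); case: (a j == b i);
    case: (b j == b i) => //= _ _ _ _ _ _; ring.
have fullA : row_full A.
  apply/row_fullP.
  exists (2^-1 *: row_mx (row_mx 1%:M 1%:M) (- 1%:M)).
  rewrite -scalemxAl AE !mul_row_col mulNmx !mul1mx A123 scale_scalar_mx.
  by rewrite mulVf // pnatr_eq0.
have [r rP] := spanning_subfamily fullA.
exists (fun i => phi (r i)) => d; have [c cP] := rP d.
by exists c => j; rewrite cP; apply: eq_bigr => i _; rewrite mxE.
Qed.

(** Sylvester reduction of a diagonal form: each term c x^2 becomes plus or
    minus the square of sqrt |c| x, in a positive or a negative coordinate
    according to the sign of c.  The map r locates the coordinates of u among
    the positive ones. *)
Lemma diagonal_form_minkowski (R : realType) (V : Type) (d m : nat)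
    (u : V -> 'rV[R]_d) (f : 'I_m -> V -> R) (c : 'I_m -> R) :
  exists p q : nat, [/\ (d <= p)%N, (p + q = d + m)%N &
    exists (H : V -> 'rV[R]_(p + q)) (r : 'I_d -> 'I_(p + q)),
      (forall v i, H v 0 (r i) = u v 0 i) /\
      forall v w, minkowski_form (H v - H w) (H v - H w) =
        \sum_i (u v 0 i - u w 0 i) ^+ 2
        + \sum_j c j * (f j v - f j w) ^+ 2].
Proof.
pose A := [set j | 0 <= c j]%SET.
exists (d + #|A|)%N, #|~: A|%SET; split; first exact: leq_addr.
  by rewrite -addnA cardsC card_ord.
pose g (B : {set 'I_m}) (v : V) :=
  \row_(k < #|B|) (Num.sqrt `|c (enum_val k)| * f (enum_val k) v).
exists (fun v => row_mx (row_mx (u v) (g A v)) (g (~: A)%SET v)),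
  (fun i => lshift _ (lshift _ i)); split=> [v i|v w].
  by rewrite !row_mxEl.
have gE (B : {set 'I_m}) :
    \sum_(k < #|B|) (g B v - g B w) 0 k * (g B v - g B w) 0 k
    = \sum_(j in B) `|c j| * (f j v - f j w) ^+ 2.
  rewrite [RHS]big_enum_val; apply: eq_bigr => k _; rewrite !mxE.
  by rewrite -mulrBr -expr2 exprMn sqr_sqrtr.
rewrite /minkowski_form !opp_row_mx !add_row_mx big_split_ord /=.
under eq_bigr do rewrite !row_mxEl.
under [X in _ + X - _]eq_bigr do rewrite row_mxEl row_mxEr.
under [X in _ - X]eq_bigr do rewrite row_mxEr.
rewrite !gE -addrA; congr (_ + _).
  by apply: eq_bigr => i _; rewrite !mxE -expr2.
rewrite [RHS](bigID (mem A)) /= -sumrN; congr (_ + _).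
  by apply: eq_bigr => j; rewrite inE => /ger0_norm ->.
apply: eq_big => j; first by rewrite inE.
by rewrite !inE -ltNge => /ltr0_norm ->; rewrite mulNr opprK.
Qed.

Lemma cardfs2_pair (V : choiceType) (e : {fset V}) :
  #|` e| = 2%N -> exists v w, v != w /\ e = [fset v; w]%fset.
Proof.
have := fset_uniq e; case Ee : (enum_fset e) => [|v [|w [|]]] //=.
rewrite inE andbT => vw _; exists v, w; split=> //.
apply/fsetP => x; have -> : (x \in e) = (x \in enum_fset e) by [].
by rewrite Ee !inE.
Qed.

(** The positions u of the vertices are kept in d positive coordinates, and one
    coordinate is added for each edge to reach arbitrary squared lengths g. *)
Lemma prescribed_edge_forms (R : realType) (V : choiceType) (d : nat)
    (E : {fset {fset V}}) (u : V -> 'rV[R]_d) (g : {fset V} -> R) :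
  (forall e, e \in E -> #|` e| = 2%N) ->
  exists p q : nat, [/\ (d <= p)%N, (p + q = d + #|` E|)%N &
    exists (H : V -> 'rV[R]_(p + q)) (r : 'I_d -> 'I_(p + q)),
      (forall v i, H v 0 (r i) = u v 0 i) /\
      forall v w, [fset v; w]%fset \in E ->
        minkowski_form (H v - H w) (H v - H w) = g [fset v; w]%fset].
Proof.
move=> E2; pose en (i : 'I_#|` E|) := nth fset0 E i.
have ends i : exists ab : V * V,
    ab.1 != ab.2 /\ en i = [fset ab.1; ab.2]%fset.
  have /E2/cardfs2_pair[v [w [vw eE]]] : en i \in E by exact: mem_nth.
  by exists (v, w).
have [ab abP] := choice ends.
have [|i j|f fP] := @squared_differences_basis R _ _ (fst \o ab) (snd \o ab).
- by move=> i; case: (abP i).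
- have [_ /= <-] := abP i; have [_ <-] := abP j => /eqP.
  by rewrite nth_uniq ?fset_uniq // => /eqP /val_inj.
pose dst2 v w := \sum_i (u v 0 i - u w 0 i) ^+ 2.
have [c cP] := fP (fun i => g (en i) - dst2 (ab i).1 (ab i).2).
have [p [q [dp pq [H [r [Hr HE]]]]]] := diagonal_form_minkowski u f c.
exists p, q; split=> //; exists H, r; split=> // v w vwE.
have Qi i : minkowski_form (H (ab i).1 - H (ab i).2) (H (ab i).1 - H (ab i).2)
    = g (en i) by rewrite HE -(cP i) addrC subrK.
have Qsym : minkowski_form (H v - H w) (H v - H w) =
    minkowski_form (H w - H v) (H w - H v).
  rewrite !HE; congr (_ + _); apply: eq_bigr => j _; last congr (_ * _);
    by rewrite -sqrrN opprB.
have eI : (index [fset v; w]%fset E < #|` E|)%N by rewrite index_mem.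
have en_e : en (Ordinal eI) = [fset v; w]%fset by rewrite /en /= nth_index.
rewrite -en_e -Qi; have [] := abP (Ordinal eI); rewrite en_e.
move: (ab _) => -[a b] /= ab_neq vw_ab.
have := fset21 a b; have := fset22 a b; rewrite -vw_ab !inE.
by case/orP=> /eqP bE /orP[] /eqP aE; move: ab_neq; rewrite aE bE ?eqxx.
Qed.

(** * Simplicial isometric embeddings *)

Theorem theorem2 (R : realType) (n : nat) (P : metric_polyhedron R)
    (cptP : compact [set: P]%classic) (dimP : complex_dim (complex P) n) :
  exists p q m : nat,
    [/\ (edges (complex P) #= `I_m)%card,
        (2 * n + 1 <= p)%N,
        (p + q = 2 * n + 1 + m)%N
      & exists h : P -> 'rV[R]_(p + q), simplicial_isometric_embedding h].
Proof.
set K := complex P; set T := @triangulation R P.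
have [S [TK SK cT cS]] : homeomorphism T := triangulation_homeo P.
have [|A inA] := @compact_realization_vertices R _ K.
  have -> : [set: realization R K] = S @` [set: P].
    by apply/seteqP; split=> // x _; exists (T x).
  by apply: continuous_compact => //; exact: continuous_subspaceT.
have finE : finite_set (edges K).
  apply: (@sub_finite_set _ _ [set` fpowerset A]); last exact: finite_fset.
  by move=> e _ /=; rewrite fpowersetE; apply/fsubsetP => v _; exact: inA.
pose E := fset_set (edges K).
have E_edges e : (e \in E) = (e \in edges K) by rewrite in_fset_set.
pose t (v : vertex P) : R := (index v A)%:R.
have injt : injective t.
  move=> v w /eqP; rewrite eqr_nat => /eqP vw.
  by rewrite -(nth_index v (inA v)) vw nth_index.
pose u v : 'rV[R]_(2 * n + 1) := \row_i t v ^+ i.+1.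
(* The edge values are indexed by edges; 0 is a default elsewhere. *)
pose g2 e : R := if pselect (edges K e) is left Ke
  then signed_square (edge_value (SigSub (mem_set Ke))) else 0.
have [e|p [q [dp pq [H [r [Hr HE]]]]]] := @prescribed_edge_forms _ _ _ E u g2.
  by rewrite E_edges => /set_mem[].
exists p, q, #|` E|; split=> //.
  by rewrite -(fset_setK finE); exact/card_eq_fsetP.
pose h (x : P) := simplicial_extension A H (S x).
have hv v : h (vertex_in v) = H v.
  by rewrite /h TK simplicial_extension_vertex.
exists h; split.
- move=> s x Ks sx; rewrite [LHS]/h TK (simplicial_extensionE H inA sx).
  by apply: eq_bigr => v _; rewrite hv.
- apply: compact_topological_embedding => //.
    move=> x; apply: (continuous_comp (cS x)).
    exact: simplicial_extension_continuous.
  apply: inj_comp (can_inj SK).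
  apply: (simplicial_extension_inj inA (t := t) (r := r)) => //.
    by case: dimP.
  by move=> v i; rewrite Hr mxE.
- move=> e v w evw; rewrite !hv; have Ke : edges K (set_val e) := set_valP e.
  rewrite HE -evw; last by rewrite E_edges; exact: mem_set.
  rewrite /g2; case: pselect => // Ke'.
  by congr (signed_square (edge_value _)); exact: val_inj.
Qed.
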